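(* If there exists a $2$-$(v,k,\lambda)$ design such that $\frac{\lambda(v-1)^2}{(k-1)^2}=n$ for some positive integer $n$, then $$g(n)\geq v+1.$$
   Context: A $2$-$(v,k,\lambda)$ design is a set of $v$ points, with a set of blocks (subsets of points) of size $k$, such that each pair of points occurs in exactly $\lambda$ blocks. For a positive integer $n$ let $\Omega=\{1,2,\ldots,n\}$. A set system on $\Omega$ is a collection $\mathcal{F}=\{A_1,\ldots,A_t\}$ of distinct subsets of $\Omega$. A set system $\mathcal{F}$ is called an intersecting family if $A\cap B\neq\emptyset$ for any $A,B\in\mathcal{F}$. The number $g(n)$ denotes the maximum cardinality $t$ of an intersecting family $\mathcal{F}=\{A_1,\ldots,A_t\}$ on $\Omega$ satisfying $|A_i\cap A_j|=n^{-1}|A_i||A_j|$ for all $1\leq i<j\leq t$.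
   Formalization: The formal theorem additionally assumes k < v; without it the claim fails, since for k = v ≥ 2 the single full block is a 2-(v,v,1) design with n = 1, while g(1) = 1 < v + 1. *)

(* Defs.v *)
From mathcomp Require Import all_boot all_order all_algebra.

Set Implicit Arguments.
Unset Strict Implicit.
Unset Printing Implicit Defensive.

Import GRing.Theory.

Local Open Scope ring_scope.

(* The blocks form a set, so there are no repeated blocks.  The trivial
   design k = v, whose only block is the whole point set, is allowed here;
   the usual convention k < v has to be assumed separately. *)
Definition is_2design (T : finType) (blocks : {set {set T}})
    (v k lambda : nat) : Prop :=
  [/\ #|T| = v,
      forall B : {set T}, B \in blocks -> #|B| = k
    & forall x y : T, x != y ->
        #|[set B in blocks | (x \in B) && (y \in B)]| = lambda].

Definition exists_2design (v k lambda : nat) : Prop :=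
  exists (T : finType) (blocks : {set {set T}}), is_2design blocks v k lambda.

(* A and B may coincide, so the empty set belongs to no intersecting family. *)
Definition intersecting (n : nat) (F : {set {set 'I_n}}) : bool :=
  [forall A in F, forall B in F, A :&: B != set0].

Definition product_intersections (n : nat) (F : {set {set 'I_n}}) : bool :=
  [forall A in F, forall B in F, (A != B) ==>
    (#|A :&: B|%:R == n%:R^-1 * #|A|%:R * #|B|%:R :> rat)].

Definition g (n : nat) : nat :=
  \max_(F : {set {set 'I_n}} | intersecting F && product_intersections F) #|F|.

(* Main.v *)
Require Import Defs.
From mathcomp Require Import all_boot all_order all_algebra.
From mathcomp Require Import zify.

(* Let r = lambda (v - 1) / (k - 1) be the number of blocks through a point, so
   that n lambda = r ^ 2.  The sets of blocks through each of the v points have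
   size r and meet pairwise in lambda = r * r / n blocks.  There are v r / k <= n
   blocks, so these sets embed in {1, ..., n}, and the whole ground set, which
   satisfies the product condition with every set, can be added to them. *)

Import GRing.Theory Num.Theory.

Local Open Scope ring_scope.

Definition blocks_through {T : finType} (blocks : {set {set T}}) (x : T) :
    {set {set T}} :=
  [set B in blocks | x \in B].

Lemma blocks_throughI (T : finType) (blocks : {set {set T}}) (x y : T) :
  blocks_through blocks x :&: blocks_through blocks y =
  [set B in blocks | (x \in B) && (y \in B)].
Proof. by apply/setP => B; rewrite !inE; case: (B \in blocks). Qed.

(** Count the pairs [(B, y)] with [x] and [y != x] both in [B], first by [B], then by [y]. *)
Lemma card_blocks_through {T : finType} {blocks : {set {set T}}}
    {v k lambda : nat} (x : T) :
  is_2design blocks v k lambda ->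
  (#|blocks_through blocks x| * k.-1 = lambda * v.-1)%N.
Proof.
move=> [cardT card_block card_pair].
have <- : (\sum_(B in blocks_through blocks x) \sum_(y in B :\ x) 1 =
           #|blocks_through blocks x| * k.-1)%N.
  rewrite -sum_nat_const; apply: eq_bigr => B.
  rewrite inE => /andP[/card_block cardB xB].
  by rewrite sum1_card -cardB (cardsD1 x B) xB.
rewrite (exchange_big_dep (fun y => y != x)) /=; last first.
  by move=> B y _; rewrite !inE => /andP[].
have <- : #|[set~ x]| = v.-1 by rewrite cardsC1 cardT.
rewrite mulnC -sum_nat_const [RHS](eq_bigl (fun y => y != x)); last first.
  by move=> y; rewrite !inE.
apply: eq_bigr => y yx; rewrite -(card_pair x y) 1?eq_sym // -sum1_card.
by apply: eq_bigl => B; rewrite !inE yx -andbA.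
Qed.

(** Count the incident point-block pairs in two ways. *)
Lemma card_incidences {T : finType} {blocks : {set {set T}}}
    {v k lambda : nat} :
  is_2design blocks v k lambda ->
  (\sum_(x : T) #|blocks_through blocks x| = #|blocks| * k)%N.
Proof.
move=> [_ card_block _].
under eq_bigr do rewrite -sum1_card.
rewrite (exchange_big_dep (mem blocks)) /=; last first.
  by move=> x B _; rewrite inE => /andP[].
rewrite -sum_nat_const; apply: eq_bigr => B Bblocks.
rewrite -(card_block B Bblocks) -[RHS]sum1_card.
by apply: eq_bigl => x; rewrite inE Bblocks.
Qed.

(** Elements are numbered by their position in [enum A]; values of [f] off [A] are irrelevant. *)
Lemma exists_in_inj_ord {T : finType} {A : {set T}} {n : nat} :
  (0 < n)%N -> (#|A| <= n)%N -> exists f : T -> 'I_n, {in A &, injective f}.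
Proof.
case: n => // n _ leAn; exists (fun x => inord (index x (enum A))).
move=> x y xA yA /(congr1 val).
have lt_index z : z \in A -> (index z (enum A) < n.+1)%N.
  by move=> zA; apply: leq_trans leAn; rewrite cardE index_mem mem_enum.
rewrite /= !inordK ?lt_index // => eq_xy.
rewrite -[x in LHS](nth_index x (s := enum A)) ?mem_enum // eq_xy.
by rewrite nth_index ?mem_enum.
Qed.

(** Each degenerate value of [lambda], [v] or [k] would make the rational quotient 0, against
    [0 < n]; the equation then moves to [nat]. *)
Lemma design_parameters {T : finType} {blocks : {set {set T}}}
    {v k lambda n : nat} :
  (0 < n)%N -> (k < v)%N -> is_2design blocks v k lambda ->
  lambda%:R * (v%:R - 1) ^+ 2 / (k%:R - 1) ^+ 2 = n%:R :> rat ->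
  [/\ (0 < lambda)%N, (1 < k)%N & (n * k.-1 ^ 2 = lambda * v.-1 ^ 2)%N].
Proof.
move=> n_gt0 lt_kv [cardT card_block card_pair] def_n.
have n_neq0 : n%:R != 0 :> rat by rewrite pnatr_eq0 -lt0n.
have lambda_gt0 : (0 < lambda)%N.
  rewrite lt0n; apply: contraNneq n_neq0 => lambda0.
  by rewrite -def_n lambda0 !mul0r.
have v_gt1 : (1 < v)%N.
  suff : v != 1 by lia.
  apply: contraNneq n_neq0 => v1.
  by rewrite -def_n v1 subrr expr0n mulr0 mul0r.
(* As [lambda > 0], two distinct points lie in a common block, which is therefore nonempty. *)
have k_gt0 : (0 < k)%N.
  have [x [y [_ _ xy]]] : exists x y : T, [/\ x \in T, y \in T & x != y].
    by apply/card_gt1P; rewrite cardT.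
  have := lambda_gt0; rewrite -(card_pair x y xy) card_gt0 => /set0Pn[B].
  rewrite inE => /and3P[/card_block <- xB _].
  by rewrite card_gt0; apply/set0Pn; exists x.
(* For [k = 1] the denominator vanishes, and division by 0 yields 0. *)
have k_neq1 : k != 1.
  apply: contraNneq n_neq0 => k1.
  by rewrite -def_n k1 subrr expr0n invr0 mulr0.
split=> //; first by lia.
apply/eqP; rewrite -(eqr_nat rat) natrM natrX natrM natrX -def_n.
rewrite -!subn1 !natrB //; last by lia.
by rewrite divfK // expf_neq0 // subr_eq0 -[1]/(1%:R) eqr_nat.
Qed.

Theorem theorem2p3 (v k lambda n : nat) (n_gt0 : (0 < n)%N) (k_lt_v : (k < v)%N)
  (design : exists_2design v k lambda)
  (def_n : lambda%:R * (v%:R - 1) ^+ 2 / (k%:R - 1) ^+ 2 = n%:R :> rat) :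
  (v + 1 <= g n)%N.
Proof.
have [T [blocks D]] := design.
have [lambda_gt0 k_gt1 nk] := design_parameters n_gt0 k_lt_v D def_n.
have [cardT _ card_pair] := D.
have [x0 _] : exists x : T, x \in T by apply/card_gt0P; rewrite cardT; lia.
pose S := blocks_through blocks; pose r := #|S x0|.
have rk : (r * k.-1 = lambda * v.-1)%N by exact: card_blocks_through.
have cardS x : #|S x| = r.
  apply/eqP; rewrite -(eqn_pmul2r (m := k.-1)) ?rk; last by lia.
  by apply/eqP; exact: card_blocks_through.
have bk : (#|blocks| * k = v * r)%N.
  rewrite -(card_incidences D) (eq_bigr (fun=> r)) => [|x _]; last exact: cardS.
  by rewrite sum_nat_const cardT.
(* Both sides times [k.-1 ^ 2] equal [(lambda * v.-1) ^ 2]. *)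
have nlambda : (n * lambda = r ^ 2)%N.
  have : (n * lambda * k.-1 ^ 2 = r ^ 2 * k.-1 ^ 2)%N.
    by rewrite -expnMn rk mulnAC nk mulnAC mulnn -expnMn.
  by move/eqP; rewrite eqn_pmul2r => [/eqP //|]; rewrite expn_gt0; lia.
have lambda_lt_r : (lambda < r)%N.
  rewrite -(ltn_pmul2r (m := k.-1)) ?rk ?ltn_pmul2l; lia.
(* Here [r * lambda < r * r = n * lambda]. *)
have r_lt_n : (r < n)%N.
  rewrite -(ltn_pmul2r lambda_gt0) nlambda -mulnn ltn_pmul2l //; lia.
have le_blocks_n : (#|blocks| <= n)%N.
  (* Times [k.-1], this reduces to [v * k.-1 <= k * v.-1], which holds since [k < v]. *)
  have le_lambda_r : (v * lambda <= k * r)%N.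
    rewrite -(leq_pmul2r (m := k.-1)); last by lia.
    rewrite -mulnA -[leqRHS]mulnA rk.
    by rewrite mulnCA [leqRHS]mulnCA leq_pmul2l //; nia.
  (* With [b] blocks, [b * k * lambda = v * r * lambda <= k * r ^ 2 = n * k * lambda]. *)
  rewrite -(leq_pmul2r (m := k * lambda)); last by nia.
  rewrite mulnA bk mulnCA nlambda; nia.
have [f f_inj] := exists_in_inj_ord n_gt0 le_blocks_n.
have S_sub x : {subset S x <= blocks} by move=> B; rewrite inE => /andP[].
have cardfS x : #|f @: S x| = r.
  by rewrite card_in_imset ?cardS // => B C /S_sub ? /S_sub ?; exact: f_inj.
have cardfSI x y : x != y -> #|f @: S x :&: f @: S y| = lambda.
  move=> xy; rewrite -imsetI; last by move=> B C /S_sub ? /S_sub ?; exact: f_inj.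
  rewrite card_in_imset => [|B C]; first by rewrite blocks_throughI card_pair.
  by rewrite !(in_setI _ (S x)) => /andP[/S_sub ? _] /andP[/S_sub ? _]; exact: f_inj.
pose points : {set {set 'I_n}} := [set f @: S x | x : T].
(* The ground set is new because [r < n], and distinct points give distinct sets because
   [lambda < r]. *)
have cardF : #|setT |: points| = (v + 1)%N.
  rewrite cardsU1 card_imset ?cardT => [|x y eq_xy].
    suff -> : setT \notin points by rewrite addnC.
    apply/imsetP => -[x _ /(congr1 (fun A : {set 'I_n} => #|A|))].
    by rewrite cardfS cardsT card_ord; lia.
  apply: contraTeq lambda_lt_r => /cardfSI.
  by rewrite -eq_xy setIid cardfS => ->; rewrite ltnn.
have n_neq0 : n%:R != 0 :> rat by rewrite pnatr_eq0 -lt0n.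
rewrite -cardF; apply: leq_bigmax_cond; apply/andP; split.
  (* The intersections have size [n], [r] or [lambda], all positive. *)
  apply/forall_inP => A FA; apply/forall_inP => B FB; rewrite -card_gt0.
  case/setU1P: FA => [->|/imsetP[x _ ->]]; case/setU1P: FB => [->|/imsetP[y _ ->]].
  - by rewrite setTI cardsT card_ord.
  - by rewrite setTI cardfS; lia.
  - by rewrite setIT cardfS; lia.
  - have [->|/cardfSI -> //] := eqVneq x y.
    by rewrite setIid cardfS; lia.
apply/forall_inP => A FA; apply/forall_inP => B FB; apply/implyP => AB.
case/setU1P: FA AB => [->|/imsetP[x _ ->]].
  by rewrite setTI cardsT card_ord mulVf // mul1r.
case/setU1P: FB => [->|/imsetP[y _ ->]] AB.
  by rewrite setIT cardsT card_ord mulrAC mulVf // mul1r.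
have xy : x != y by apply: contraNneq AB => ->.
(* Two point sets satisfy the product condition by [n * lambda = r ^ 2]. *)
by rewrite cardfSI // !cardfS -mulrA -natrM mulnn -nlambda natrM mulKf.
Qed.
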